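(* Let $q\in[0,1[$ and $\tau\in[-1,1]$, and let $\phi(q):=(1+q^2-2q\tau)^{-1/2}$. Write $D:=q\,\frac{\mathrm{d}}{\mathrm{d}q}$. Then $$\frac{1}{4\pi}\sum_{n=0}^\infty \left(n+\tfrac12\right)^4(2n+1)\,q^nP_n(\tau) = \frac{1}{64\pi}\Big(\phi(q)+10\,D\phi(q)+40\,D^2\phi(q)+80\,D^3\phi(q)+80\,D^4\phi(q)+32\,D^5\phi(q)\Big),$$ where $$D\phi(q)=\frac{\tau q-q^2}{(1+q^2-2q\tau)^{3/2}},$$ $$D^2\phi(q)=\frac{\tau q-2q^2}{(1+q^2-2q\tau)^{3/2}}+\frac{3(\tau q-q^2)^2}{(1+q^2-2q\tau)^{5/2}},$$ $$D^3\phi(q)=\frac{\tau q-4q^2}{(1+q^2-2q\tau)^{3/2}}+\frac{9(\tau q-q^2)(\tau q-2q^2)}{(1+q^2-2q\tau)^{5/2}}+\frac{15(\tau q-q^2)^3}{(1+q^2-2q\tau)^{7/2}},$$ $$D^4\phi(q)=\frac{\tau q-8q^2}{(1+q^2-2q\tau)^{3/2}}+\frac{12(\tau q-4q^2)(\tau q-q^2)+9(\tau q-2q^2)^2}{(1+q^2-2q\tau)^{5/2}}+\frac{90(\tau q-q^2)^2(\tau q-2q^2)}{(1+q^2-2q\tau)^{7/2}}+\frac{105(\tau q-q^2)^4}{(1+q^2-2q\tau)^{9/2}},$$ $$\begin{aligned}D^5\phi(q)={}&\frac{\tau q-16q^2}{(1+q^2-2q\tau)^{3/2}}+\frac{15(\tau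 q-8q^2)(\tau q-q^2)+30(\tau q-4q^2)(\tau q-2q^2)}{(1+q^2-2q\tau)^{5/2}}\\&+\frac{150(\tau q-4q^2)(\tau q-q^2)^2+225(\tau q-2q^2)^2(\tau q-q^2)}{(1+q^2-2q\tau)^{7/2}}\\&+\frac{1050(\tau q-q^2)^3(\tau q-2q^2)}{(1+q^2-2q\tau)^{9/2}}+\frac{945(\tau q-q^2)^5}{(1+q^2-2q\tau)^{11/2}}.\end{aligned}$$
   Context: $[0,1[$ is the half-open interval $\{q\in\mathbb{R}:0\le q<1\}$. $P_n$ is the Legendre polynomial of degree $n$ with the standard normalization $P_n(1)=1$. For fixed $\tau\in[-1,1]$, $\phi$ is regarded as a function of $q$; the formula defines a smooth function on $-1<q<1$. $D^k$ denotes the $k$-fold composition of the operator $g\mapsto q\,\frac{\mathrm{d}g}{\mathrm{d}q}$. The convention $0^0=1$ is used for $q^n$ at $q=0$, $n=0$. *)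

(* Defs.v *)
From Stdlib Require Import Reals Factorial.
From Coquelicot Require Import Coquelicot.
Open Scope R_scope.

(** Legendre polynomials by Rodrigues' formula
      P_n(x) = 1/(2^n n!) d^n/dx^n (x^2 - 1)^n,
    whose constant gives the normalization P_n(1) = 1. *)
Definition legendre (n : nat) (x : R) : R :=
  / (2 ^ n * INR (fact n)) * Derive_n (fun t => (t ^ 2 - 1) ^ n) n x.

(** [Rpower] is the genuine real power only for a positive base;
    here 1 + q^2 - 2 q tau > 0 whenever |q| < 1 and |tau| <= 1. *)
Definition phi (tau q : R) : R := Rpower (1 + q ^ 2 - 2 * q * tau) (- (1 / 2)).

Definition Dop (g : R -> R) (q : R) : R := q * Derive g q.

Definition Dpow (k : nat) (g : R -> R) : R -> R := Nat.iter k Dop g.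

(* Main.v *)
Require Import Defs.
From Stdlib Require Import Reals Factorial Lra Lia.
From Coquelicot Require Import Coquelicot.
Open Scope R_scope.

(** Multiplying the weight out, [16 (n + 1/2)^4 (2n + 1) = (1 + 2n)^5], and
    [D = q d/dq] multiplies the coefficient of [q^n] by [n]. So the sum is
    [1/16 (1 + 2 D)^5] applied to the generating function
    [sum_n P_n(tau) q^n], which is [phi tau q] for [|q| < 1]; the coefficients
    1, 10, 40, 80, 80, 32 are those of [(1 + 2 D)^5].

    The generating function is obtained from Rodrigues' formula in three steps.

    - Bonnet's three-term recurrence ([legendre_recurrence]). The auxiliary
      quantity is [Q_n = c_n d^(n-1)/dx^(n-1) (x^2 - 1)^n] with
      [c_n = 1/(2^n n!)]. Differentiating [(x^2 - 1)^(n+1)] once gives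
      [P_(n+1) = x P_n + n Q_n] ([legendre_S]); applying [d^(n-1)/dx^(n-1)] to
      [x ((x^2 - 1)^n)' = 2n ((x^2 - 1)^n + (x^2 - 1)^(n-1))] gives
      [x P_n - P_(n-1) = (n + 1) Q_n] ([legendre_pred]). Eliminating [Q_n]
      gives the recurrence.

    - The bound [|P_n| <= 1] on [[-1, 1]] ([legendre_bounded]), so that the
      power series has radius of convergence at least 1. The recurrence says
      [P_(n+1) - x P_n = - n/(n+1) (P_(n-1) - x P_n)], so the quadratic form
      [P_n^2 + P_(n-1)^2 - 2 x P_n P_(n-1)], which can be completed to a square
      in either variable, does not increase with [n] ([legendre_energy]).

    - The recurrence translates into
      [(1 + q^2 - 2 q tau) y' = (tau - q) y] for the sum [y] of the power
      series ([legendre_ode]). Since [phi] satisfies the same equation and both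
      are 1 at [q = 0], they agree ([phi_PSeries]).

    The closed forms come from [phi' = (tau - q) phi^3] ([is_derive_phi]):
    every [D^k phi] is a polynomial in [q], [tau] and [phi], and
    [phi^m = (1 + q^2 - 2 q tau)^(-m/2)]. *)

(** * Derivatives of [t g(t)] *)

Definition smooth (f : R -> R) : Prop := forall n x, ex_derive_n f n x.

Lemma smooth_ext (f g : R -> R) :
  (forall x, f x = g x) -> smooth f -> smooth g.
Proof.
  intros E Hf n x. now apply ex_derive_n_ext with (2 := Hf n x).
Qed.

Lemma smooth_near (f : R -> R) (n : nat) (x : R) :
  smooth f -> locally x (fun y => forall k, (k <= n)%nat -> ex_derive_n f k y).
Proof. intros Hf. now apply filter_forall. Qed.

(** Leibniz' rule when one factor is the identity. At [n = 0] the second term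
    vanishes with its coefficient, so the truncation [pred 0 = 0] is harmless. *)
Lemma Derive_n_mult_id (g : R -> R) (n : nat) (x : R) :
  smooth g ->
  Derive_n (fun t => t * g t) n x
  = x * Derive_n g n x + INR n * Derive_n g (pred n) x.
Proof.
  intros Hg. revert x. induction n as [|n IH]; intros x.
  - simpl. ring.
  - change (Derive (Derive_n (fun t => t * g t) n) x
            = x * Derive (Derive_n g n) x + INR (S n) * Derive_n g n x).
    rewrite (Derive_ext _ _ x IH).
    assert (H0 := Hg (S n) x : ex_derive (Derive_n g n) x).
    apply is_derive_unique.
    (* The truncated [pred] forces the first step to be done apart. *)
    destruct n as [|n].
    + simpl in *. auto_derive; [now repeat split | ring].
    + assert (H1 := Hg (S n) x : ex_derive (Derive_n g n) x).
      change (Derive_n g (pred (S n))) with (Derive_n g n).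
      set (g0 := Derive_n g n) in *. set (g1 := Derive_n g (S n)) in *.
      change (is_derive (fun y => y * g1 y + INR (S n) * g0 y) x
        (x * Derive g1 x + INR (S (S n)) * g1 x)).
      change (g1 x) with (Derive g0 x).
      rewrite (S_INR (S n)). set (c := INR (S n)).
      auto_derive; [now repeat split|].
      change (fun y => g0 y) with g0. change (fun y => g1 y) with g1.
      change (g1 x) with (Derive g0 x). ring.
Qed.

Lemma smooth_mult_id (g : R -> R) : smooth g -> smooth (fun t => t * g t).
Proof.
  intros Hg [|n] x; [exact I|].
  change (ex_derive (Derive_n (fun t => t * g t) n) x).
  apply ex_derive_ext with
    (f := fun y => y * Derive_n g n y + INR n * Derive_n g (pred n) y).
  { intros t. now rewrite Derive_n_mult_id. }
  assert (H0 := Hg (S n) x : ex_derive (Derive_n g n) x).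
  assert (H1 := Hg (S (pred n)) x : ex_derive (Derive_n g (pred n)) x).
  now auto_derive.
Qed.

(** * Bonnet's recurrence from Rodrigues' formula *)

Lemma smooth_pow_sqr_minus_1 (n : nat) : smooth (fun t => (t ^ 2 - 1) ^ n).
Proof.
  induction n as [|n IH].
  - intros k x. exact (ex_derive_n_const 1 k x).
  - apply smooth_ext with
      (fun t => t * (t * (t ^ 2 - 1) ^ n) - (t ^ 2 - 1) ^ n).
    { intros x. simpl. ring. }
    intros k x. apply ex_derive_n_minus; apply smooth_near; [|exact IH].
    exact (smooth_mult_id _ (smooth_mult_id _ IH)).
Qed.

Lemma Derive_n_shift (f : R -> R) (n : nat) (x : R) :
  Derive_n f (S n) x = Derive_n (Derive f) n x.
Proof.
  replace (S n) with (n + 1)%nat by lia. now rewrite <- Derive_n_comp.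
Qed.

Lemma Derive_pow_sqr_minus_1 (n : nat) (t : R) :
  Derive (fun t => (t ^ 2 - 1) ^ S n) t
  = 2 * INR (S n) * (t * (t ^ 2 - 1) ^ n).
Proof.
  apply is_derive_unique. auto_derive; [trivial|].
  change (pred (S n)) with n. change (t * (t * 1) + - (1)) with (t ^ 2 - 1).
  change (match n with 0%nat => 1 | S _ => INR n + 1 end) with (INR (S n)).
  ring.
Qed.

(** The antiderivative of [P_(n+1)] that Rodrigues' formula suggests, namely
    [Q_(n+1) = c_(n+1) d^n/dx^n (x^2 - 1)^(n+1)]; the index is shifted because
    [Q_0] would require a negative order of differentiation. *)
Definition legendre_prim (n : nat) (x : R) : R :=
  / (2 ^ S n * INR (fact (S n))) * Derive_n (fun t => (t ^ 2 - 1) ^ S n) n x.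

Lemma rodrigues_const_neq_0 (n : nat) : 2 ^ n * INR (fact n) <> 0.
Proof.
  apply Rmult_integral_contrapositive. split;
    [apply pow_nonzero; lra | apply INR_fact_neq_0].
Qed.

Lemma rodrigues_const_S (n : nat) :
  / (2 ^ n * INR (fact n)) = / (2 ^ S n * INR (fact (S n))) * (2 * INR (S n)).
Proof.
  assert (H := rodrigues_const_neq_0 n).
  rewrite fact_simpl, mult_INR. change (2 ^ S n) with (2 * 2 ^ n).
  field. repeat split; try (apply not_0_INR; lia).
  - apply INR_fact_neq_0.
  - apply pow_nonzero; lra.
Qed.

(** One of the [n + 2] derivatives is spent on
    [((x^2 - 1)^(n+2))' = 2 (n + 2) x (x^2 - 1)^(n+1)], and the factor [x] is
    then carried through the others. *)
Lemma legendre_S (n : nat) (x : R) :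
  legendre (S (S n)) x
  = x * legendre (S n) x + INR (S n) * legendre_prim n x.
Proof.
  unfold legendre, legendre_prim.
  rewrite Derive_n_shift.
  rewrite (Derive_n_ext _ _ (S n) x (Derive_pow_sqr_minus_1 (S n))).
  rewrite Derive_n_scal_l, Derive_n_mult_id by apply smooth_pow_sqr_minus_1.
  rewrite (rodrigues_const_S (S n)). change (pred (S n)) with n. ring.
Qed.

(** With [f_k = (t^2 - 1)^k], both sides of
    [t f_(n+1)' = 2 (n + 1) (f_(n+1) + f_n)] are differentiated [n] times. *)
Lemma legendre_pred (n : nat) (x : R) :
  x * legendre (S n) x - legendre n x = INR (S (S n)) * legendre_prim n x.
Proof.
  unfold legendre, legendre_prim.
  set (f := fun k t => (t ^ 2 - 1) ^ k).
  assert (Sf : forall k, smooth (f k)) by apply smooth_pow_sqr_minus_1.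
  assert (Df : forall t, Derive (f (S n)) t = 2 * INR (S n) * (t * f n t))
    by apply Derive_pow_sqr_minus_1.
  assert (Euler : Derive_n (fun t => t * Derive (f (S n)) t) n x
    = 2 * INR (S n) * (Derive_n (f (S n)) n x + Derive_n (f n) n x)).
  { rewrite <- Derive_n_plus by now apply smooth_near.
    rewrite <- Derive_n_scal_l. apply Derive_n_ext. intros t.
    rewrite Df. unfold f. simpl. ring. }
  assert (SD : smooth (Derive (f (S n)))).
  { intros [|k] y; [exact I|].
    apply ex_derive_ext with (f := Derive_n (f (S n)) (S k)).
    - intros t. apply Derive_n_shift.
    - apply (Sf (S n) (S (S k))). }
  (* Expanding the left side by Leibniz' rule leaves derivatives of
     [f_(n+1)] of orders [n + 1] and [n] only. *)
  rewrite Derive_n_mult_id in Euler by assumption.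
  rewrite <- Derive_n_shift in Euler.
  assert (E' : INR n * Derive_n (Derive (f (S n))) (pred n) x
               = INR n * Derive_n (f (S n)) n x).
  { destruct n as [|n]; [simpl; ring|].
    now rewrite <- Derive_n_shift. }
  rewrite E' in Euler.
  fold (f (S n)) (f n).
  rewrite (rodrigues_const_S n), (S_INR (S n)).
  set (c := / (2 ^ S n * INR (fact (S n)))) in *.
  rewrite S_INR in *.
  transitivity (c * (x * Derive_n (f (S n)) (S n) x)
    - c * (2 * (INR n + 1)) * Derive_n (f n) n x); [ring|].
  replace (x * Derive_n (f (S n)) (S n) x) with
   (2 * (INR n + 1) * (Derive_n (f (S n)) n x + Derive_n (f n) n x)
    - INR n * Derive_n (f (S n)) n x) by lra.
  ring.
Qed.

(** Bonnet's recurrence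
    [(n + 2) P_(n+2) = (2n + 3) x P_(n+1) - (n + 1) P_n], arranged to compare
    the deviations of the two neighbours of [P_(n+1)] from [x P_(n+1)]. *)
Lemma legendre_recurrence (n : nat) (x : R) :
  INR (S (S n)) * (legendre (S (S n)) x - x * legendre (S n) x)
  = - INR (S n) * (legendre n x - x * legendre (S n) x).
Proof.
  assert (H := legendre_pred n x).
  rewrite legendre_S.
  replace (legendre n x) with
    (x * legendre (S n) x - INR (S (S n)) * legendre_prim n x) by lra.
  ring.
Qed.

Lemma legendre_0 (x : R) : legendre 0 x = 1.
Proof. unfold legendre. simpl. field. Qed.

Lemma legendre_1 (x : R) : legendre 1 x = x.
Proof.
  unfold legendre.
  change (Derive_n (fun t => (t ^ 2 - 1) ^ 1) 1 x)
    with (Derive (fun t => (t ^ 2 - 1) ^ 1) x).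
  rewrite Derive_pow_sqr_minus_1. simpl. field.
Qed.

(** * The bound on the Legendre polynomials and the radius of convergence *)

(** The left side is [P_(n+1)^2 + P_n^2 - 2 x P_n P_(n+1)], which is symmetric
    in the two polynomials. Completing the square with the roles exchanged and
    applying [legendre_recurrence], the step from [n] to [n + 1] multiplies one
    of the two squares by [((n + 1)/(n + 2))^2] and keeps the other. *)
Lemma legendre_energy (x : R) (n : nat) :
  -1 <= x <= 1 ->
  (legendre (S n) x - x * legendre n x) ^ 2 + (1 - x ^ 2) * legendre n x ^ 2
  <= 1 - x ^ 2.
Proof.
  intros Hx. induction n as [|n IH].
  - rewrite legendre_0, legendre_1. nra.
  - refine (Rle_trans _ _ _ _ IH).
    set (d := legendre n x - x * legendre (S n) x).
    set (r := INR (S n) / INR (S (S n))).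
    assert (P1 : 0 < INR (S (S n))) by (apply lt_0_INR; lia).
    assert (Hr : 0 <= r <= 1).
    { unfold r. rewrite (S_INR (S n)) in *. assert (H := pos_INR (S n)). split.
      - apply Rle_mult_inv_pos; lra.
      - apply Rmult_le_reg_r with (1 := P1).
        unfold Rdiv. rewrite Rmult_assoc, Rinv_l; lra. }
    assert (E : legendre (S (S n)) x - x * legendre (S n) x = - r * d).
    { apply Rmult_eq_reg_l with (INR (S (S n))); [|lra].
      rewrite legendre_recurrence. unfold r, d. field. lra. }
    rewrite E.
    assert (H : (- r * d) ^ 2 <= d ^ 2).
    { replace ((- r * d) ^ 2) with (r ^ 2 * d ^ 2) by ring.
      assert (0 <= d ^ 2) by apply pow2_ge_0.
      assert (r ^ 2 <= 1) by nra. nra. }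
    unfold d in *. lra.
Qed.

(** Inside the interval the energy bound is divided by [1 - x^2]. At the
    endpoints the energy is the square [(P_(n+1) - x P_n)^2] and vanishes, so
    [P_(n+1) = x P_n]. *)
Lemma legendre_bounded (x : R) (n : nat) :
  -1 <= x <= 1 -> Rabs (legendre n x) <= 1.
Proof.
  intros Hx.
  assert (H : legendre n x ^ 2 <= 1).
  { destruct (Rlt_le_dec 0 (1 - x ^ 2)) as [Hlt|Hge].
    - assert (E := legendre_energy x n Hx).
      assert (0 <= (legendre (S n) x - x * legendre n x) ^ 2) by apply pow2_ge_0.
      nra.
    - assert (X : x ^ 2 = 1) by nra.
      induction n as [|n IH]; [rewrite legendre_0; lra|].
      assert (E := legendre_energy x n Hx).
      rewrite X in E. assert (Z : legendre (S n) x - x * legendre n x = 0) by nra.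
      replace (legendre (S n) x) with (x * legendre n x) by lra.
      replace ((x * legendre n x) ^ 2) with (x ^ 2 * legendre n x ^ 2) by ring.
      rewrite X. lra. }
  apply Rabs_le. split; nra.
Qed.

Lemma legendre_CV_radius (tau q : R) :
  -1 <= tau <= 1 -> Rabs q < 1 ->
  Rbar_lt (Rabs q) (CV_radius (fun n => legendre n tau)).
Proof.
  intros Ht Hq. apply Rbar_lt_le_trans with (Finite 1); [exact Hq|].
  apply CV_radius_bounded. exists 1. intros n.
  rewrite pow1, Rmult_1_r. now apply legendre_bounded.
Qed.

(** * The generating function *)

(** The recurrence read coefficient by coefficient. To have one series on each
    side, the equation is first rearranged as
    [y' + q (q y') + q y = tau (2 q y' + y)]. *)
Lemma legendre_ode (tau q : R) :
  -1 <= tau <= 1 -> Rabs q < 1 ->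
  (1 + q ^ 2 - 2 * q * tau) * PSeries (PS_derive (fun n => legendre n tau)) q
  = (tau - q) * PSeries (fun n => legendre n tau) q.
Proof.
  intros Ht Hq. set (a := fun n => legendre n tau). set (b := PS_derive a).
  assert (Ha : ex_pseries a q)
    by now apply CV_radius_inside, legendre_CV_radius.
  assert (Hb : ex_pseries b q).
  { apply CV_radius_inside. unfold b. rewrite CV_radius_derive.
    now apply legendre_CV_radius. }
  assert (Hb1 := ex_pseries_incr_1 _ _ Hb).
  assert (Hb2 := ex_pseries_incr_1 _ _ Hb1).
  assert (Ha1 := ex_pseries_incr_1 _ _ Ha).
  assert (E : PSeries (PS_plus (PS_plus b (PS_incr_1 (PS_incr_1 b))) (PS_incr_1 a)) q
   = PSeries (PS_scal tau (PS_plus (PS_scal 2 (PS_incr_1 b)) a)) q).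
  { apply PSeries_ext. intros [|[|n]];
    unfold PS_plus, PS_scal, PS_incr_1, b, PS_derive, a, plus, scal, zero;
    cbn -[INR legendre];
    unfold mult; cbn -[INR legendre].
    - rewrite legendre_1, legendre_0. simpl. ring.
    - assert (R := legendre_recurrence 0 tau).
      rewrite legendre_0, legendre_1 in *. simpl INR in *. lra.
    - assert (R := legendre_recurrence (S n) tau). rewrite !S_INR in *. lra. }
  rewrite PSeries_scal, !PSeries_plus, PSeries_scal, !PSeries_incr_1 in E;
    try assumption.
  - lra.
  - apply ex_pseries_scal; [apply Rmult_comm | assumption].
  - apply ex_pseries_plus; assumption.
Qed.

(** The minimum over [tau] in [[-1, 1]] is [(1 - |q|)^2]. *)
Lemma kernel_pos (tau q : R) :
  -1 <= tau <= 1 -> Rabs q < 1 -> 0 < 1 + q ^ 2 - 2 * q * tau.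
Proof. intros Ht Hq. apply Rabs_def2 in Hq. destruct (Rle_dec 0 q); nra. Qed.

Lemma phi_pow (tau q : R) (n : nat) :
  phi tau q ^ n = / Rpower (1 + q ^ 2 - 2 * q * tau) (INR n / 2).
Proof.
  rewrite <- Rpower_Ropp, <- Rpower_pow by apply exp_pos.
  unfold phi. rewrite Rpower_mult. f_equal. field.
Qed.

Lemma is_derive_phi (tau q : R) :
  0 < 1 + q ^ 2 - 2 * q * tau ->
  is_derive (phi tau) q ((tau - q) * phi tau q ^ 3).
Proof.
  intros Hw.
  replace ((tau - q) * phi tau q ^ 3) with
    (scal (2 * q - 2 * tau)
      (- (1 / 2) * Rpower (1 + q ^ 2 - 2 * q * tau) (- (1 / 2) - 1))).
  - apply (is_derive_comp (fun w => Rpower w (- (1 / 2)))).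
    + apply is_derive_Reals. now apply derivable_pt_lim_power.
    + auto_derive; [trivial | ring].
  - rewrite phi_pow, <- Rpower_Ropp.
    replace (- (INR 3 / 2)) with (- (1 / 2) - 1) by (simpl; field).
    unfold scal; simpl; unfold mult; simpl. field.
Qed.

Lemma phi_pos (tau q : R) : 0 < phi tau q.
Proof. apply exp_pos. Qed.

Lemma phi_sqr (tau q : R) :
  0 < 1 + q ^ 2 - 2 * q * tau ->
  (1 + q ^ 2 - 2 * q * tau) * phi tau q ^ 2 = 1.
Proof.
  intros Hw. rewrite phi_pow.
  replace (INR 2 / 2) with 1 by (simpl; field).
  rewrite Rpower_1 by assumption. field. lra.
Qed.

Lemma phi_0 (tau : R) : phi tau 0 = 1.
Proof.
  unfold phi. replace (1 + 0 ^ 2 - 2 * 0 * tau) with 1 by ring.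
  unfold Rpower. rewrite ln_1, Rmult_0_r. apply exp_0.
Qed.

Lemma eq_of_derive_0 (f : R -> R) (q : R) :
  (forall t, Rabs t < 1 -> is_derive f t 0) -> Rabs q < 1 -> f q = f 0.
Proof.
  intros Hf Hq. apply Rabs_def2 in Hq.
  destruct (Rtotal_order q 0) as [H|[->|H]].
  - apply eq_is_derive; [|exact H]. intros t Ht. apply Hf, Rabs_def1; lra.
  - reflexivity.
  - symmetry. apply eq_is_derive; [|exact H].
    intros t Ht. apply Hf, Rabs_def1; lra.
Qed.

(** The quotient of the two solutions of the differential equation has zero
    derivative, and it is 1 at the origin. *)
Lemma phi_PSeries (tau q : R) :
  -1 <= tau <= 1 -> Rabs q < 1 ->
  phi tau q = PSeries (fun n => legendre n tau) q.
Proof.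
  intros Ht Hq. set (a := fun n => legendre n tau).
  assert (C : PSeries a q / phi tau q = PSeries a 0 / phi tau 0).
  { apply (eq_of_derive_0 (fun t => PSeries a t / phi tau t)); [|exact Hq].
    intros t Hlt.
    assert (Hw := kernel_pos tau t Ht Hlt).
    assert (P := phi_pos tau t).
    assert (N := phi_sqr tau t Hw).
    assert (O := legendre_ode tau t Ht Hlt). fold a in O.
    replace 0 with ((PSeries (PS_derive a) t * phi tau t
      - PSeries a t * ((tau - t) * phi tau t ^ 3)) / phi tau t ^ 2).
    - apply is_derive_div.
      + now apply is_derive_PSeries, legendre_CV_radius.
      + now apply is_derive_phi.
      + lra.
    - replace (PSeries a t * ((tau - t) * phi tau t ^ 3)) with
        (phi tau t ^ 3 * ((tau - t) * PSeries a t)) by ring.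
      rewrite <- O.
      replace (phi tau t ^ 3 * ((1 + t ^ 2 - 2 * t * tau) * PSeries (PS_derive a) t))
        with (((1 + t ^ 2 - 2 * t * tau) * phi tau t ^ 2)
          * (phi tau t * PSeries (PS_derive a) t)) by ring.
      rewrite N. field. lra. }
  rewrite PSeries_0, phi_0 in C. unfold a at 2 in C. rewrite legendre_0 in C.
  assert (P := phi_pos tau q).
  apply (f_equal (fun y => y * phi tau q)) in C.
  field_simplify in C; lra.
Qed.

(** * The operator [q d/dq] on power series *)

(** [PS_derive] followed by the shift [PS_incr_1] multiplies the [n]-th
    coefficient by [n]; neither changes the radius of convergence, which is
    carried along because differentiation needs it at every step. *)
Lemma Dpow_PSeries (f : R -> R) (a : nat -> R) (k : nat) :
  (forall q, Rabs q < 1 -> Rbar_lt (Rabs q) (CV_radius a)) ->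
  (forall q, Rabs q < 1 -> f q = PSeries a q) ->
  forall q, Rabs q < 1 ->
    Rbar_lt (Rabs q) (CV_radius (fun n => INR n ^ k * a n)) /\
    Dpow k f q = PSeries (fun n => INR n ^ k * a n) q.
Proof.
  intros Ra Hf. induction k as [|k IH]; intros q Hq.
  - rewrite (CV_radius_ext _ a) by (intros; simpl; ring).
    rewrite (PSeries_ext _ a) by (intros; simpl; ring). auto.
  - set (b := fun n => INR n ^ k * a n) in *.
    assert (E : forall n, INR n ^ S k * a n = PS_incr_1 (PS_derive b) n).
    { intros [|n]; unfold PS_incr_1, PS_derive, b, zero; simpl; ring. }
    rewrite (CV_radius_ext _ _ E), (PSeries_ext _ _ _ E).
    rewrite CV_radius_incr_1, CV_radius_derive, PSeries_incr_1.
    split; [now apply IH|].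
    change (q * Derive (Dpow k f) q = q * PSeries (PS_derive b) q).
    rewrite <- Derive_PSeries by now apply IH.
    f_equal. apply Derive_ext_loc.
    apply (locally_open (fun t => Rabs t < 1)); auto.
    + apply open_comp with (D := fun y => y < 1); [|apply open_lt].
      intros x _. apply continuous_Rabs.
    + intros x Hx. now apply IH.
Qed.

(** * Closed forms of [D^k phi] *)

(** A closed form valid on the open set where [1 + q^2 - 2 q tau] is positive
    may be differentiated there. *)
Lemma Dpow_S_closed (tau : R) (k : nat) (F F' : R -> R) :
  (forall q, 0 < 1 + q ^ 2 - 2 * q * tau -> Dpow k (phi tau) q = F q) ->
  (forall q, 0 < 1 + q ^ 2 - 2 * q * tau -> is_derive F q (F' q)) ->
  forall q, 0 < 1 + q ^ 2 - 2 * q * tau ->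
    Dpow (S k) (phi tau) q = q * F' q.
Proof.
  intros HF HF' q Hq.
  change (q * Derive (Dpow k (phi tau)) q = q * F' q). f_equal.
  rewrite <- (is_derive_unique _ _ _ (HF' q Hq)).
  apply Derive_ext_loc.
  apply (locally_open (fun t => 0 < 1 + t ^ 2 - 2 * t * tau)); auto.
  apply open_comp with (D := fun w => 0 < w); [|apply open_gt].
  intros t _. apply (ex_derive_continuous (fun t => 1 + t ^ 2 - 2 * t * tau)).
  now auto_derive.
Qed.

(** Differentiates a polynomial expression in [q] and [phi tau q] and leaves
   the algebraic identity that identifies the result with the expected one. *)
Ltac derive_phi :=
  match goal with
  | Hw : 0 < 1 + ?q ^ 2 - 2 * ?q * ?tau |- is_derive _ ?q _ =>
      let D := fresh in
      assert (D := is_derive_phi tau q Hw);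
      auto_derive;
      [ repeat split; now exists ((tau - q) * phi tau q ^ 3)
      | change (Derive (fun x => phi tau x) q) with (Derive (phi tau) q);
        rewrite (is_derive_unique _ _ _ D) ]
  end.

Lemma Dpow_1_phi (tau q : R) :
  0 < 1 + q ^ 2 - 2 * q * tau ->
  Dpow 1 (phi tau) q = (tau * q - q ^ 2) * phi tau q ^ 3.
Proof.
  intros Hq.
  rewrite (Dpow_S_closed tau 0 (phi tau) _ (fun _ _ => eq_refl)
    (is_derive_phi tau) q Hq).
  ring.
Qed.

(** From here on the derivative of the preceding closed form is supplied
    explicitly. Since [tau q - c q^2 = q (tau - c q)], it is the new closed
    form with one such factor of each term divided by [q]. *)
Lemma Dpow_2_phi (tau q : R) :
  0 < 1 + q ^ 2 - 2 * q * tau ->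
  Dpow 2 (phi tau) q
  = (tau * q - 2 * q ^ 2) * phi tau q ^ 3
    + 3 * (tau * q - q ^ 2) ^ 2 * phi tau q ^ 5.
Proof.
  intros Hq.
  rewrite (Dpow_S_closed tau 1 _
   (fun q => (tau - 2 * q) * phi tau q ^ 3
     + 3 * (tau * q - q ^ 2) * (tau - q) * phi tau q ^ 5)
    (Dpow_1_phi tau)); [ring| |exact Hq].
  clear q Hq. intros q Hq. derive_phi. ring.
Qed.

Lemma Dpow_3_phi (tau q : R) :
  0 < 1 + q ^ 2 - 2 * q * tau ->
  Dpow 3 (phi tau) q
  = (tau * q - 4 * q ^ 2) * phi tau q ^ 3
    + 9 * (tau * q - q ^ 2) * (tau * q - 2 * q ^ 2) * phi tau q ^ 5
    + 15 * (tau * q - q ^ 2) ^ 3 * phi tau q ^ 7.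
Proof.
  intros Hq.
  rewrite (Dpow_S_closed tau 2 _
    (fun q => (tau - 4 * q) * phi tau q ^ 3
      + 9 * (tau - q) * (tau * q - 2 * q ^ 2) * phi tau q ^ 5
      + 15 * (tau * q - q ^ 2) ^ 2 * (tau - q) * phi tau q ^ 7)
    (Dpow_2_phi tau)); [ring| |exact Hq].
  clear q Hq. intros q Hq. derive_phi. ring.
Qed.

Lemma Dpow_4_phi (tau q : R) :
  0 < 1 + q ^ 2 - 2 * q * tau ->
  Dpow 4 (phi tau) q
  = (tau * q - 8 * q ^ 2) * phi tau q ^ 3
    + (12 * (tau * q - 4 * q ^ 2) * (tau * q - q ^ 2)
       + 9 * (tau * q - 2 * q ^ 2) ^ 2) * phi tau q ^ 5
    + 90 * (tau * q - q ^ 2) ^ 2 * (tau * q - 2 * q ^ 2) * phi tau q ^ 7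
    + 105 * (tau * q - q ^ 2) ^ 4 * phi tau q ^ 9.
Proof.
  intros Hq.
  rewrite (Dpow_S_closed tau 3 _
    (fun q => (tau - 8 * q) * phi tau q ^ 3
      + (12 * (tau * q - 4 * q ^ 2) * (tau - q)
         + 9 * (tau * q - 2 * q ^ 2) * (tau - 2 * q)) * phi tau q ^ 5
      + 90 * (tau * q - q ^ 2) * (tau - q) * (tau * q - 2 * q ^ 2)
        * phi tau q ^ 7
      + 105 * (tau * q - q ^ 2) ^ 3 * (tau - q) * phi tau q ^ 9)
    (Dpow_3_phi tau)); [ring| |exact Hq].
  clear q Hq. intros q Hq. derive_phi. ring.
Qed.

Lemma Dpow_5_phi (tau q : R) :
  0 < 1 + q ^ 2 - 2 * q * tau ->
  Dpow 5 (phi tau) q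
  = (tau * q - 16 * q ^ 2) * phi tau q ^ 3
    + (15 * (tau * q - 8 * q ^ 2) * (tau * q - q ^ 2)
       + 30 * (tau * q - 4 * q ^ 2) * (tau * q - 2 * q ^ 2)) * phi tau q ^ 5
    + (150 * (tau * q - 4 * q ^ 2) * (tau * q - q ^ 2) ^ 2
       + 225 * (tau * q - 2 * q ^ 2) ^ 2 * (tau * q - q ^ 2)) * phi tau q ^ 7
    + 1050 * (tau * q - q ^ 2) ^ 3 * (tau * q - 2 * q ^ 2) * phi tau q ^ 9
    + 945 * (tau * q - q ^ 2) ^ 5 * phi tau q ^ 11.
Proof.
  intros Hq.
  rewrite (Dpow_S_closed tau 4 _
    (fun q => (tau - 16 * q) * phi tau q ^ 3
      + (15 * (tau * q - 8 * q ^ 2) * (tau - q)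
         + 30 * (tau * q - 4 * q ^ 2) * (tau - 2 * q)) * phi tau q ^ 5
      + (150 * (tau * q - 4 * q ^ 2) * (tau * q - q ^ 2) * (tau - q)
         + 225 * (tau * q - 2 * q ^ 2) ^ 2 * (tau - q)) * phi tau q ^ 7
      + 1050 * (tau * q - q ^ 2) ^ 2 * (tau - q) * (tau * q - 2 * q ^ 2)
        * phi tau q ^ 9
      + 945 * (tau * q - q ^ 2) ^ 4 * (tau - q) * phi tau q ^ 11)
    (Dpow_4_phi tau)); [ring| |exact Hq].
  clear q Hq. intros q Hq. derive_phi. ring.
Qed.

(** * The weighted Legendre series *)

Lemma is_series_Dpow_phi (tau q : R) (k : nat) :
  -1 <= tau <= 1 -> Rabs q < 1 ->
  is_series (fun n => INR n ^ k * legendre n tau * q ^ n) (Dpow k (phi tau) q).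
Proof.
  intros Ht Hq.
  destruct (Dpow_PSeries (phi tau) (fun n => legendre n tau) k
    (fun t Hlt => legendre_CV_radius tau t Ht Hlt)
    (fun t Hlt => phi_PSeries tau t Ht Hlt) q Hq) as [Hr ->].
  apply Series_correct, ex_series_Rabs, CV_disk_inside, Hr.
Qed.

(** The weight is [(2n + 1)^5 / 16], expanded by the binomial theorem. *)
Lemma is_series_half_integer_fifth_power (tau q : R) :
  -1 <= tau <= 1 -> Rabs q < 1 ->
  is_series
    (fun n => (INR n + 1 / 2) ^ 4 * (2 * INR n + 1) * q ^ n * legendre n tau)
    (/ 16 * (phi tau q + 10 * Dpow 1 (phi tau) q + 40 * Dpow 2 (phi tau) q
      + 80 * Dpow 3 (phi tau) q + 80 * Dpow 4 (phi tau) q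
      + 32 * Dpow 5 (phi tau) q)).
Proof.
  intros Ht Hq.
  assert (S := fun k => is_series_Dpow_phi tau q k Ht Hq).
  apply is_series_ext with (2 :=
    is_series_scal_l (/ 16) _ _
     (is_series_plus _ _ _ _ (is_series_plus _ _ _ _ (is_series_plus _ _ _ _
     (is_series_plus _ _ _ _ (is_series_plus _ _ _ _ (S 0%nat)
        (is_series_scal_l 10 _ _ (S 1%nat)))
        (is_series_scal_l 40 _ _ (S 2%nat)))
        (is_series_scal_l 80 _ _ (S 3%nat)))
        (is_series_scal_l 80 _ _ (S 4%nat)))
        (is_series_scal_l 32 _ _ (S 5%nat)))).
  intros n. unfold plus, mult; cbn -[INR legendre]. field.
Qed.

Theorem mainTheorem2 (q tau : R) (hq : 0 <= q < 1) (htau : -1 <= tau <= 1) :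
  (ex_series (fun n : nat =>
      (INR n + 1 / 2) ^ 4 * (2 * INR n + 1) * q ^ n * legendre n tau) /\
   1 / (4 * PI) * Series (fun n : nat =>
      (INR n + 1 / 2) ^ 4 * (2 * INR n + 1) * q ^ n * legendre n tau)
   = 1 / (64 * PI) *
     (phi tau q + 10 * Dpow 1 (phi tau) q + 40 * Dpow 2 (phi tau) q
      + 80 * Dpow 3 (phi tau) q + 80 * Dpow 4 (phi tau) q
      + 32 * Dpow 5 (phi tau) q)) /\
  Dpow 1 (phi tau) q
  = (tau * q - q ^ 2) / Rpower (1 + q ^ 2 - 2 * q * tau) (3 / 2) /\
  Dpow 2 (phi tau) q
  = (tau * q - 2 * q ^ 2) / Rpower (1 + q ^ 2 - 2 * q * tau) (3 / 2)
    + 3 * (tau * q - q ^ 2) ^ 2 / Rpower (1 + q ^ 2 - 2 * q * tau) (5 / 2) /\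
  Dpow 3 (phi tau) q
  = (tau * q - 4 * q ^ 2) / Rpower (1 + q ^ 2 - 2 * q * tau) (3 / 2)
    + 9 * (tau * q - q ^ 2) * (tau * q - 2 * q ^ 2)
      / Rpower (1 + q ^ 2 - 2 * q * tau) (5 / 2)
    + 15 * (tau * q - q ^ 2) ^ 3 / Rpower (1 + q ^ 2 - 2 * q * tau) (7 / 2) /\
  Dpow 4 (phi tau) q
  = (tau * q - 8 * q ^ 2) / Rpower (1 + q ^ 2 - 2 * q * tau) (3 / 2)
    + (12 * (tau * q - 4 * q ^ 2) * (tau * q - q ^ 2)
       + 9 * (tau * q - 2 * q ^ 2) ^ 2)
      / Rpower (1 + q ^ 2 - 2 * q * tau) (5 / 2)
    + 90 * (tau * q - q ^ 2) ^ 2 * (tau * q - 2 * q ^ 2)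
      / Rpower (1 + q ^ 2 - 2 * q * tau) (7 / 2)
    + 105 * (tau * q - q ^ 2) ^ 4
      / Rpower (1 + q ^ 2 - 2 * q * tau) (9 / 2) /\
  Dpow 5 (phi tau) q
  = (tau * q - 16 * q ^ 2) / Rpower (1 + q ^ 2 - 2 * q * tau) (3 / 2)
    + (15 * (tau * q - 8 * q ^ 2) * (tau * q - q ^ 2)
       + 30 * (tau * q - 4 * q ^ 2) * (tau * q - 2 * q ^ 2))
      / Rpower (1 + q ^ 2 - 2 * q * tau) (5 / 2)
    + (150 * (tau * q - 4 * q ^ 2) * (tau * q - q ^ 2) ^ 2
       + 225 * (tau * q - 2 * q ^ 2) ^ 2 * (tau * q - q ^ 2))
      / Rpower (1 + q ^ 2 - 2 * q * tau) (7 / 2)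
    + 1050 * (tau * q - q ^ 2) ^ 3 * (tau * q - 2 * q ^ 2)
      / Rpower (1 + q ^ 2 - 2 * q * tau) (9 / 2)
    + 945 * (tau * q - q ^ 2) ^ 5
      / Rpower (1 + q ^ 2 - 2 * q * tau) (11 / 2).
Proof.
  assert (Hq : Rabs q < 1) by (apply Rabs_def1; lra).
  assert (Hw := kernel_pos tau q htau Hq).
  split.
  - assert (S := is_series_half_integer_fifth_power tau q htau Hq).
    split; [now exists (/ 16 * (phi tau q + 10 * Dpow 1 (phi tau) q
      + 40 * Dpow 2 (phi tau) q + 80 * Dpow 3 (phi tau) q
      + 80 * Dpow 4 (phi tau) q + 32 * Dpow 5 (phi tau) q))|].
    rewrite (is_series_unique _ _ S). field. apply PI_neq0.
  - rewrite Dpow_1_phi, Dpow_2_phi, Dpow_3_phi, Dpow_4_phi, Dpow_5_phi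
      by exact Hw.
    rewrite !phi_pow. unfold Rdiv.
    replace (INR 3) with 3 by (simpl; ring).
    replace (INR 5) with 5 by (simpl; ring).
    replace (INR 7) with 7 by (simpl; ring).
    replace (INR 9) with 9 by (simpl; ring).
    replace (INR 11) with 11 by (simpl; ring).
    repeat split.
Qed.
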